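(* Consider the Birkhoff interpolation problem with conditions $\delta_{x_{\beta_1}}\circ D_x^{\alpha_1},\dots,\delta_{x_{\beta_N}}\circ D_x^{\alpha_N}$ and prescribed values $y_{\beta_1,\alpha_1},\dots,y_{\beta_N,\alpha_N}\in\mathbb{F}$, and let $\{g_{-1,0}(x),g_{0,1}(x),\dots,g_{N-2,N-1}(x)\}$ and $p_{N-1}(x)$ be the output of Algorithm 1 (described in the context) on this input. Then $\{g_{-1,0}(x),g_{0,1}(x),\dots,g_{N-2,N-1}(x)\}$ is a Newton-type basis for this Birkhoff interpolation problem. Furthermore, it is a strongly proper interpolation basis, and $p_{N-1}(x)$ is the corresponding interpolation polynomial, i.e. the unique element $p$ of $\mathrm{span}\{g_{-1,0},g_{0,1},\dots,g_{N-2,N-1}\}$ with $p^{(\alpha_i)}(x_{\beta_i})=y_{\beta_i,\alpha_i}$ for all $i=1,\dots,N$.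
   Context: $\mathbb{F}$ is $\mathbb{R}$ or $\mathbb{C}$, $D_x=\frac{d}{dx}$, $x_0,\dots,x_n\in\mathbb{F}$ are pairwise distinct nodes, and $\delta_{x_\beta}$ is evaluation at $x_\beta$; thus $\delta_{x_\beta}\circ D_x^{\alpha}(p)=p^{(\alpha)}(x_\beta)$. The $N$ interpolation conditions $\delta_{x_{\beta_1}}\circ D_x^{\alpha_1},\dots,\delta_{x_{\beta_N}}\circ D_x^{\alpha_N}$ (with $\beta_i\in\{0,\dots,n\}$, $\alpha_i\in\mathbb{N}=\{0,1,2,\dots\}$) are ordered so that $\alpha_1\le\alpha_2\le\dots\le\alpha_N$, and $\beta_s<\beta_{s+1}$ whenever $\alpha_s=\alpha_{s+1}$. Proper basis: polynomials $q_0,\dots,q_{i-1}$ form a proper interpolation basis for the first $i$ conditions if they form a basis of an $i$-dimensional subspace $\mathcal{F}\subset\mathbb{F}[x]$ such that for any prescribed values $y_1,\dots,y_i\in\mathbb{F}$ there is a unique $p\in\mathcal{F}$ with $p^{(\alpha_l)}(x_{\beta_l})=y_l$, $l=1,\dots,i$. Strongly proper basis: a proper interpolation basis $\{q_0,\dots,q_{N-1}\}$ (in this order) for the $N$ conditions is a strongly proper interpolation basis if for each $i=1,\dots,N$, $\{q_0,\dots,q_{i-1}\}$ is a proper interpolation basis for the first $i$ conditions. Newton-type basis: this is the same as a triangular sequence for the conditions, i.e. a sequence $(h_1,\dots,h_N)$ of polynomials such that, with $L_i=\delta_{x_{\beta_i}}\circ D_x^{\alpha_i}$, $L_i(h_j)=1$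 for $i=j$ and $L_i(h_j)=0$ for $i<j$. Here $h_k=g_{k-2,k-1}$, $k=1,\dots,N$. Algorithm 1. Initialization: $g_{-1,i}(x):=x^{\alpha_1+i}$ for $i=0,\dots,N-1$; $p_{-1}(x):=0$; $p_0(x):=\frac{y_{\beta_1,\alpha_1}}{\alpha_1!}x^{\alpha_1}$, given as the value of $p_{-1}(x)+\frac{y_{\beta_1,\alpha_1}-p_{-1}^{(\alpha_1)}(x_{\beta_1})}{g_{-1,0}^{(\alpha_1)}(x_{\beta_1})}g_{-1,0}(x)$; $\mathrm{List}:=\{2,3,\dots,N\}$. While $\mathrm{List}\neq\varnothing$, do the following: (1) set $k:=\min(\mathrm{List})$; (2) for $j=0,1,\dots,k-2$ in order, set $$g_{j,k-1}(x):=g_{j-1,k-1}(x)-\frac{g_{j-1,k-1}^{(\alpha_{j+1})}(x_{\beta_{j+1}})}{g_{j-1,j}^{(\alpha_{j+1})}(x_{\beta_{j+1}})}\,g_{j-1,j}(x);$$ (3) if $g_{k-2,k-1}^{(\alpha_k)}(x_{\beta_k})\neq 0$, then remove $k$ from $\mathrm{List}$ and set $$p_{k-1}(x):=p_{k-2}(x)+\frac{y_{\beta_k,\alpha_k}-p_{k-2}^{(\alpha_k)}(x_{\beta_k})}{g_{k-2,k-1}^{(\alpha_k)}(x_{\beta_k})}\,g_{k-2,k-1}(x);$$ (4) otherwise, for $d=k-1,k,\dots,N-1$ replace $g_{-1,d}(x)$ by $x\cdot g_{-1,d}(x)$ (and return to the start of the loop). The output is the monomial basis $\{g_{-1,0},g_{-1,1},\dots,g_{-1,N-1}\}$,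 the set $\{g_{-1,0},g_{0,1},\dots,g_{N-2,N-1}\}$ and the polynomial $p_{N-1}$. That the algorithm terminates is asserted separately, just before this statement.
   Formalization: Algorithm 1 does not normalize its output (for N=1, α_1=2 it gives x^2 with L_1(x^2)=2), so ''Newton-type basis'' is proved as: all L_k(h_k) are nonzero and the rescaled polynomials h_k/L_k(h_k) form a triangular sequence. *)

(* Defs.v *)
From HB Require Import structures.
From mathcomp Require Import all_boot all_order all_algebra.
From mathcomp Require Import reals complex.
From Stdlib Require Import Relation_Operators.

Set Implicit Arguments.
Unset Strict Implicit.
Unset Printing Implicit Defensive.

Import Order.TTheory GRing.Theory Num.Theory.
Local Open Scope ring_scope.

Variant scalar_kind := RealScalars | ComplexScalars.

Definition scalars (R : realType) (K : scalar_kind) : numFieldType :=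
  match K with
  | RealScalars => R
  | ComplexScalars => R[i]
  end.

(* Throughout there are N = m.+1 interpolation conditions; they are numbered
   from 0, so that i : 'I_m.+1 stands for the condition number i + 1 and
   ord0 : 'I_m.+1 for the first one. *)

Definition ordered_conditions (n m : nat)
    (alpha : 'I_m.+1 -> nat) (beta : 'I_m.+1 -> 'I_n.+1) : Prop :=
  forall s t : 'I_m.+1, t = s.+1 :> nat ->
    (alpha s <= alpha t)%N /\ (alpha s = alpha t -> (beta s < beta t)%N).

Definition cond (F : fieldType) (n m : nat) (x : 'I_n.+1 -> F)
    (alpha : 'I_m.+1 -> nat) (beta : 'I_m.+1 -> 'I_n.+1)
    (i : 'I_m.+1) (q : {poly F}) : F :=
  (q^`(alpha i)).[x (beta i)].

Definition lin_indep (F : fieldType) (i : nat) (q : 'I_i -> {poly F}) : Prop :=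
  forall c : 'I_i -> F, \sum_(j < i) c j *: q j = 0 -> forall j, c j = 0.

Definition in_span (F : fieldType) (i : nat) (q : 'I_i -> {poly F})
    (p : {poly F}) : Prop :=
  exists c : 'I_i -> F, p = \sum_(j < i) c j *: q j.

Definition interpolates (F : fieldType) (i : nat)
    (L : 'I_i -> {poly F} -> F) (y : 'I_i -> F) (p : {poly F}) : Prop :=
  forall l, L l p = y l.

Definition proper_basis (F : fieldType) (i : nat)
    (L : 'I_i -> {poly F} -> F) (q : 'I_i -> {poly F}) : Prop :=
  lin_indep q /\
  forall y : 'I_i -> F, exists! p : {poly F}, in_span q p /\ interpolates L y p.

Definition strongly_proper_basis (F : fieldType) (N : nat)
    (L : 'I_N -> {poly F} -> F) (q : 'I_N -> {poly F}) : Prop :=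
  proper_basis L q /\
  forall (i : nat) (le_iN : (i <= N)%N), (0 < i)%N ->
    proper_basis (fun l : 'I_i => L (widen_ord le_iN l))
                 (fun l : 'I_i => q (widen_ord le_iN l)).

Definition triangular_sequence (F : fieldType) (N : nat)
    (L : 'I_N -> {poly F} -> F) (h : 'I_N -> {poly F}) : Prop :=
  (forall i, L i (h i) = 1) /\
  (forall i j : 'I_N, (i < j)%N -> L i (h j) = 0).

(* The algorithm does not divide its output polynomials by their pivots
   L k (h k): its first one is X^alpha_1, on which the first condition takes
   the value alpha_1!.  Hence the normalization L k (h k) = 1 of a triangular
   sequence is required only after rescaling each h k to pivot 1. *)
Definition newton_type_basis (F : fieldType) (N : nat)
    (L : 'I_N -> {poly F} -> F) (h : 'I_N -> {poly F}) : Prop :=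
  (forall k, L k (h k) != 0) /\
  triangular_sequence L (fun k => (L k (h k))^-1 *: h k).

(* The variables of the algorithm.  As indices g_{j,k} and p_k start at -1,
   they are shifted by one: [tab s j k] is g_{j-1,k} and [sol s k] is p_{k-1}.
   With the conditions numbered from 0, the element k of [todo s] stands for
   the element k + 1 of List; its column is k, its pivot polynomial
   g_{k-1,k} is [tab s k k], and accepting it defines p_k, [sol s k.+1]. *)
Record state (F : fieldType) (m : nat) := State {
  todo : {set 'I_m.+1};
  tab : nat -> 'I_m.+1 -> {poly F};
  sol : nat -> {poly F}
}.

Definition init_state (F : fieldType) (m : nat) (alpha : 'I_m.+1 -> nat)
    (y : 'I_m.+1 -> F) : state F m :=
  State [set k : 'I_m.+1 | (0 < k)%N]
    (fun j k => if j == 0%N then 'X^(alpha ord0 + k) else 0)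
    (fun j => if j == 1%N
              then (y ord0 / (alpha ord0)`!%:R) *: 'X^(alpha ord0) else 0).

Definition set_entry (F : fieldType) (m : nat)
    (g : nat -> 'I_m.+1 -> {poly F}) (j : nat) (k : 'I_m.+1) (q : {poly F}) :
    nat -> 'I_m.+1 -> {poly F} :=
  fun j' k' => if (j' == j) && (k' == k) then q else g j' k'.

(* Loop (2); [enum 'I_m.+1] lists the indices in increasing order. *)
Definition eliminate (F : fieldType) (m : nat) (L : 'I_m.+1 -> {poly F} -> F)
    (k : 'I_m.+1) (g : nat -> 'I_m.+1 -> {poly F}) :
    nat -> 'I_m.+1 -> {poly F} :=
  foldl (fun g (j : 'I_m.+1) =>
           set_entry g j.+1 k (g j k - (L j (g j k) / L j (g j j)) *: g j j))
        g [seq j : 'I_m.+1 <- enum 'I_m.+1 | (j < k)%N].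

(* Action (4): multiply g_{-1,d} by x for all columns d >= k. *)
Definition raise_monomials (F : fieldType) (m : nat) (k : 'I_m.+1)
    (g : nat -> 'I_m.+1 -> {poly F}) : nat -> 'I_m.+1 -> {poly F} :=
  fun j d => if (j == 0%N) && (k <= d)%N then 'X * g j d else g j d.

Definition set_sol (F : fieldType) (p : nat -> {poly F}) (k : nat)
    (q : {poly F}) : nat -> {poly F} :=
  fun k' => if k' == k then q else p k'.

(* One iteration of the while loop. *)
Inductive step (F : fieldType) (m : nat) (L : 'I_m.+1 -> {poly F} -> F)
    (y : 'I_m.+1 -> F) (s : state F m) : state F m -> Prop :=
| step_accept (k : 'I_m.+1) (g := eliminate L k (tab s)) :
    k \in todo s -> (forall d, d \in todo s -> (k <= d)%N) ->
    L k (g k k) != 0 ->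
    step L y s
      (State (todo s :\ k) g
        (set_sol (sol s) k.+1
          (sol s k + ((y k - L k (sol s k)) / L k (g k k)) *: g k k)))
| step_raise (k : 'I_m.+1) (g := eliminate L k (tab s)) :
    k \in todo s -> (forall d, d \in todo s -> (k <= d)%N) ->
    L k (g k k) = 0 ->
    step L y s (State (todo s) (raise_monomials k g) (sol s)).

(* [algorithm_output L alpha y h P]: the algorithm terminates, with
   h k = g_{k-1,k} and P = p_{N-1}. *)
Definition algorithm_output (F : fieldType) (m : nat)
    (L : 'I_m.+1 -> {poly F} -> F) (alpha : 'I_m.+1 -> nat)
    (y : 'I_m.+1 -> F) (h : 'I_m.+1 -> {poly F}) (P : {poly F}) : Prop :=
  exists s : state F m,
    [/\ clos_refl_trans _ (step L y) (init_state alpha y) s,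
        todo s = set0,
        (forall k, h k = tab s k k) & P = sol s m.+1].

(* Main.v *)
(* A triangular matrix with nonzero diagonal is invertible, so it is enough that
   the matrix L_i (h_j) has this shape.  The loop maintains that for the accepted
   columns, whose number is c below: subtracting a multiple of the pivot
   polynomial of column j kills condition j and leaves the earlier conditions at
   0, and a column is accepted only when its own pivot is nonzero.  The
   correction added to the interpolant is a multiple of the newly accepted
   polynomial, hence does not disturb the earlier interpolation conditions. *)

From HB Require Import structures.
Require Import Defs.
From mathcomp Require Import all_boot all_order all_algebra.
From mathcomp Require Import reals.
From Stdlib Require Import Relation_Operators.

Set Implicit Arguments.
Unset Strict Implicit.
Unset Printing Implicit Defensive.

Import Order.TTheory GRing.Theory Num.Theory.
Local Open Scope ring_scope.

(** * Linear functionals on polynomials *)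

Lemma cond_scalar (F : fieldType) (n m : nat) (x : 'I_n.+1 -> F)
    (alpha : 'I_m.+1 -> nat) (beta : 'I_m.+1 -> 'I_n.+1) i :
  scalar (cond x alpha beta i).
Proof. by move=> a p q; rewrite /cond linearP hornerD hornerZ. Qed.

(** Bundles a functional known only to satisfy the linearity predicate, so that the generic laws of
    linear maps apply to it. *)
Lemma scalarE (F : fieldType) (f : {poly F} -> F) :
  scalar f -> exists g : {scalar {poly F}}, f = g.
Proof.
move=> lin_f; pose fM := GRing.isLinear.Build F {poly F} F *%R f lin_f.
pose g : {scalar {poly F}} := HB.pack f fM.
by exists g.
Qed.

Lemma scalarfB (F : fieldType) (f : {poly F} -> F) : scalar f ->
  forall a p q, f (p - a *: q) = f p - a * f q.
Proof. by case/scalarE=> g -> a p q; rewrite linearB linearZ. Qed.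

Lemma scalarfD (F : fieldType) (f : {poly F} -> F) : scalar f ->
  forall a p q, f (p + a *: q) = f p + a * f q.
Proof. by case/scalarE=> g -> a p q; rewrite linearD linearZ. Qed.

Lemma scalarfZ (F : fieldType) (f : {poly F} -> F) : scalar f ->
  forall a p, f (a *: p) = a * f p.
Proof. by case/scalarE=> g -> a p; rewrite linearZ. Qed.

Lemma scalarf_sum (F : fieldType) (f : {poly F} -> F) : scalar f ->
  forall (I : finType) (A : pred I) (a : I -> F) (q : I -> {poly F}),
  f (\sum_(j | A j) a j *: q j) = \sum_(j | A j) a j * f (q j).
Proof.
case/scalarE=> g -> I A a q; rewrite linear_sum.
by apply: eq_bigr => j _; rewrite linearZ.
Qed.

(** * Interpolation as a square linear system *)

Section ProperBasis.

Variables (F : fieldType) (N : nat) (L : 'I_N -> {poly F} -> F).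
Variable q : 'I_N -> {poly F}.
Hypothesis scalarL : forall l, scalar (L l).

Let A : 'M[F]_N := \matrix_(l, j) L l (q j).

Let mulA (c : 'cV[F]_N) l :
  (A *m c) l 0 = L l (\sum_(j < N) c j 0 *: q j).
Proof.
by rewrite scalarf_sum // mxE; apply: eq_bigr => j _; rewrite mxE mulrC.
Qed.

(** Interpolating in the span of [q] means solving [A *m c = y] for the coefficients, so [invmx A]
    gives existence and uniqueness; the case of zero values gives independence. *)
Lemma unitmx_proper_basis : A \in unitmx -> proper_basis L q.
Proof.
move=> uA; split=> [c c0 j | y].
  have: A *m (\col_j c j) = 0.
    apply/colP => l; rewrite mulA [RHS]mxE.
    under eq_bigr do rewrite mxE.
    by rewrite c0; have [f ->] := scalarE (scalarL l); rewrite linear0.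
  by move/(congr1 (mulmx (invmx A))); rewrite mulKmx // mulmx0 => /colP/(_ j);
    rewrite !mxE.
pose c := invmx A *m \col_j y j.
exists (\sum_(j < N) c j 0 *: q j); split.
  split; first by exists (fun j => c j 0).
  by move=> l; rewrite -mulA mulKVmx // mxE.
move=> _ [[b ->] Lb]; apply: eq_bigr => j _; congr (_ *: _).
suff /(congr1 (mulmx (invmx A))): A *m (\col_j b j) = \col_j y j.
  by rewrite mulKmx // => bE; rewrite /c -bE mxE.
apply/colP => l; rewrite mulA !mxE -Lb.
by congr (L l _); apply: eq_bigr => k _; rewrite mxE.
Qed.

Lemma triangular_proper_basis :
  (forall l, L l (q l) != 0) ->
  (forall l j : 'I_N, (l < j)%N -> L l (q j) = 0) ->
  proper_basis L q.
Proof.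
move=> diagL upperL; apply: unitmx_proper_basis.
rewrite unitmxE det_trig; last first.
  by apply/is_trig_mxP => l j lt_lj; rewrite mxE upperL.
by rewrite unitfE; apply/prodf_neq0 => l _; rewrite mxE.
Qed.

End ProperBasis.

(** * Elimination and the loop invariant *)

Section Algorithm.

Variables (F : fieldType) (m : nat) (L : 'I_m.+1 -> {poly F} -> F).
Hypothesis scalarL : forall i, scalar (L i).

Implicit Types (g : nat -> 'I_m.+1 -> {poly F}) (k : 'I_m.+1).

Lemma eliminate_other g k j d : d != k -> eliminate L k g j d = g j d.
Proof.
move=> neq_dk; rewrite /eliminate; elim: [seq _ <- _ | _] g => //= i s IHs g.
by rewrite IHs /set_entry (negPf neq_dk) andbF.
Qed.

Lemma eliminate_indices k :
  map (@nat_of_ord m.+1) [seq j : 'I_m.+1 <- enum 'I_m.+1 | (j < k)%N] =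
  iota 0 k.
Proof.
rewrite -(filter_map _ (fun j => j < k)%N) val_enum_ord.
by apply: (filter_iota_ltn 0); apply: ltnW.
Qed.

Lemma eliminate_vanish g k :
  (forall j : 'I_m.+1, (j < k)%N -> L j (g j j) != 0) ->
  (forall i j : 'I_m.+1, (i < j)%N -> (j < k)%N -> L i (g j j) = 0) ->
  forall i : 'I_m.+1, (i < k)%N -> L i (eliminate L k g k k) = 0.
Proof.
(* The loop is generalized to start at any [n <= k], with the indices [iota n (k - n)] still to run
   and the first [n] conditions already vanishing on [g n k]; at [n = k] this is the goal. *)
rewrite /eliminate; have := eliminate_indices k; rewrite -{2}[val k]subn0.
have: forall i : 'I_m.+1, (i < 0)%N -> L i (g 0%N k) = 0 by [].
have: (0 <= k)%N by [].
elim: [seq _ <- _ | _] 0%N g => /= [|j s IHs] n g le_nk zero_n.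
  move=> /(congr1 size); rewrite /= size_iota => /esym/eqP; rewrite subn_eq0.
  move=> le_kn _ _ i; suff -> : k = n :> nat by apply: zero_n.
  by apply/eqP; rewrite eqn_leq le_kn.
case Dr: (k - n)%N => [//|r] /= [jE sE] piv_g zero_g.
have lt_jk : (j < k)%N by rewrite jE -subn_gt0 Dr.
set g' := set_entry _ _ _ _.
have g'diag (i : 'I_m.+1) : (i < k)%N -> g' i i = g i i.
  by move=> lt_ik; rewrite /g' /set_entry -val_eqE (ltn_eqF lt_ik) andbF.
apply: (IHs n.+1).
- by rewrite -jE.
- move=> i; rewrite ltnS -jE => le_ij.
  (* The factor is chosen to cancel condition [j]; earlier conditions vanish on both terms of the
     difference. *)
  rewrite /g' /set_entry !eqxx scalarfB //; move: le_ij.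
  rewrite leq_eqVlt => /orP[/eqP/val_inj -> | lt_ij].
    by rewrite divfK ?subrr // piv_g.
  by rewrite (zero_g i j) // mulr0 subr0 jE zero_n -?jE.
- by rewrite sE subnS Dr.
- by move=> i lt_ik; rewrite g'diag // piv_g.
- by move=> i d lt_id lt_dk; rewrite g'diag // zero_g.
Qed.

Variable y : 'I_m.+1 -> F.

(** Nothing is required of the columns from [c] on: elimination works from any entry in row 0, so
    raising monomials cannot break the invariant. *)
Record loop_invariant (s : state F m) (c : nat) : Prop := LoopInvariant {
  accepted_gt0 : (0 < c)%N;
  accepted_le : (c <= m.+1)%N;
  todoE : forall k, (k \in todo s) = (c <= k)%N;
  pivot_neq0 : forall k : 'I_m.+1, (k < c)%N -> L k (tab s k k) != 0;
  pivot_vanish : forall i k : 'I_m.+1, (i < k)%N -> (k < c)%N -> L i (tab s k k) = 0;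
  sol_span : exists a : 'I_m.+1 -> F,
    sol s c = \sum_(j < m.+1 | (j < c)%N) a j *: tab s j j;
  sol_interpolates : forall i : 'I_m.+1, (i < c)%N -> L i (sol s c) = y i
}.

Lemma init_invariant (alpha : 'I_m.+1 -> nat) :
  L ord0 'X^(alpha ord0) = (alpha ord0)`!%:R ->
  (alpha ord0)`!%:R != 0 :> F ->
  loop_invariant (init_state alpha y) 1.
Proof.
have lt1 (k : 'I_m.+1) : (k < 1)%N = (k == ord0) by rewrite ltnS leqn0.
move=> L0 f0; split=> //=.
- by move=> k; rewrite inE.
- by move=> k; rewrite lt1 => /eqP -> /=; rewrite addn0 L0.
- by move=> i k lt_ik; rewrite lt1 => /eqP k0; rewrite k0 in lt_ik.
- exists (fun=> y ord0 / (alpha ord0)`!%:R).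
  by rewrite (eq_bigl _ _ lt1) big_pred1_eq /= addn0.
- by move=> i; rewrite lt1 => /eqP ->; rewrite scalarfZ // L0 divfK.
Qed.

Lemma min_todo s c k : loop_invariant s c -> k \in todo s ->
  (forall d, d \in todo s -> (k <= d)%N) -> k = c :> nat.
Proof.
move=> inv_s; rewrite (todoE inv_s) => le_ck min_k; apply/eqP.
rewrite eqn_leq le_ck andbT.
have lt_c := leq_ltn_trans le_ck (ltn_ord k).
by apply: (min_k (Ordinal lt_c)); rewrite (todoE inv_s).
Qed.

Lemma step_invariant s s' c : loop_invariant s c -> step L y s s' ->
  exists c', loop_invariant s' c'.
Proof.
move=> inv_s; case=> k g k_todo min_k Lk.
  have kE := min_todo inv_s k_todo min_k.
  have g_diag (j : 'I_m.+1) : (j < c)%N -> g j j = tab s j j.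
    rewrite -kE => lt_jk; rewrite /g eliminate_other //.
    by rewrite -val_eqE (ltn_eqF lt_jk).
  have gk_vanish (i : 'I_m.+1) : (i < k)%N -> L i (g k k) = 0.
    apply: eliminate_vanish => [j | i' j lt_i'j]; rewrite kE => lt_jc.
      exact: (pivot_neq0 inv_s).
    exact: (pivot_vanish inv_s).
  exists c.+1; split=> //=.
  - by rewrite -kE.
  - move=> d; rewrite !inE (todoE inv_s) -kE -val_eqE /=.
    by rewrite eq_sym -ltn_neqAle.
  - move=> j; rewrite ltnS leq_eqVlt -{1}kE => /orP[/eqP/val_inj -> // | lt_jc].
    by rewrite g_diag // (pivot_neq0 inv_s).
  - move=> i j lt_ij; rewrite ltnS leq_eqVlt -{1}kE.
    case/orP=> [/eqP/val_inj jk | lt_jc].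
      by rewrite jk gk_vanish // -jk.
    by rewrite g_diag // (pivot_vanish inv_s).
  - have [a solE] := sol_span inv_s.
    (* Earlier coefficients are kept; the new one is the correction factor of the accepting step. *)
    exists (fun j => if j == k then (y k - L k (sol s k)) / L k (g k k) else a j).
    rewrite /set_sol kE eqxx (bigD1 k) /= ?kE // eqxx addrC solE.
    rewrite -kE; congr (_ + _).
    apply: eq_big => [j | j lt_jk].
      by rewrite ltnS ltn_neqAle andbC.
    by rewrite (g_diag j) -?kE // ifN // -val_eqE (ltn_eqF lt_jk).
  - move=> i; rewrite /set_sol -kE eqxx scalarfD // ltnS leq_eqVlt.
    case/orP=> [/eqP/val_inj -> | lt_ik].
      by rewrite divfK // addrC subrK.
    by rewrite (gk_vanish i) // mulr0 addr0 kE (sol_interpolates inv_s) -?kE.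
have kE := min_todo inv_s k_todo min_k.
(* Raising changes only columns from [k = c] on, and elimination only column [k]. *)
have r_diag (j : 'I_m.+1) : (j < c)%N -> raise_monomials k g j j = tab s j j.
  rewrite -kE => lt_jk; rewrite /raise_monomials leqNgt lt_jk andbF /g.
  by rewrite eliminate_other // -val_eqE (ltn_eqF lt_jk).
exists c; case: inv_s => c_gt0 c_le todo_s piv van [a solE] solL.
split=> //=.
- by move=> j lt_jc; rewrite r_diag // piv.
- by move=> i j lt_ij lt_jc; rewrite r_diag // van.
- by exists a; rewrite solE; apply: eq_bigr => j lt_jc; rewrite r_diag.
Qed.

Lemma reachable_invariant s s' :
  clos_refl_trans _ (step L y) s s' ->
  (exists c, loop_invariant s c) -> exists c, loop_invariant s' c.
Proof.
by elim=> {s s'} [s s' s_s' [c /step_invariant] | // | *]; eauto.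
Qed.

End Algorithm.

Lemma cond_monomial (F : fieldType) (n m : nat) (x : 'I_n.+1 -> F)
    (alpha : 'I_m.+1 -> nat) (beta : 'I_m.+1 -> 'I_n.+1) i :
  cond x alpha beta i 'X^(alpha i) = (alpha i)`!%:R.
Proof.
by rewrite /cond derivnXn subnn ffactnn expr0 hornerMn hornerC.
Qed.

Theorem theorem9 (R : realType) (K : scalar_kind) (n m : nat)
    (x : 'I_n.+1 -> scalars R K) (alpha : 'I_m.+1 -> nat)
    (beta : 'I_m.+1 -> 'I_n.+1) (y : 'I_m.+1 -> scalars R K)
    (h : 'I_m.+1 -> {poly scalars R K}) (P : {poly scalars R K}) :
  injective x ->
  ordered_conditions alpha beta ->
  algorithm_output (cond x alpha beta) alpha y h P ->
  [/\ newton_type_basis (cond x alpha beta) h,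
      strongly_proper_basis (cond x alpha beta) h &
      unique (fun p => in_span h p /\ interpolates (cond x alpha beta) y p) P].
Proof.
move=> _ _ [s [run todo0 hE PE]].
set L := cond x alpha beta in run *.
have scalarL i : scalar (L i) by exact: cond_scalar.
have [] : exists c, loop_invariant L y s c.
  apply: (reachable_invariant scalarL run); exists 1%N; apply: init_invariant => //.
    exact: cond_monomial.
  (* Characteristic zero keeps the factorial nonzero. *)
  by rewrite pnatr_eq0 -lt0n fact_gt0.
move=> c [c_gt0 c_le todo_s piv van [a solE] solL].
have {todo_s} cE : c = m.+1.
  apply/eqP; rewrite eqn_leq c_le /= ltnNge; apply/negP => le_cm.
  by have := todo_s ord_max; rewrite todo0 inE le_cm.
have lt_c (i : 'I_m.+1) : (i < c)%N by rewrite cE.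
have diag k : L k (h k) != 0 by rewrite hE piv.
have upper (i j : 'I_m.+1) : (i < j)%N -> L i (h j) = 0.
  by move=> lt_ij; rewrite hE van.
have properL : proper_basis L h by exact: triangular_proper_basis.
split.
- split=> //; split=> [i | i j lt_ij]; rewrite scalarfZ ?mulVf //.
  by rewrite (upper i j) ?mulr0.
(* A leading principal block of a triangular matrix is triangular with the same diagonal entries. *)
- split=> // i le_iN _; apply: triangular_proper_basis => // l j lt_lj.
  exact: upper.
- have [_ /(_ y) [p [p_ok p_uniq]]] := properL.
  have {}PE : P = sol s c by rewrite PE cE.
  have P_ok : in_span h P /\ interpolates L y P.
    split=> [|l]; last by rewrite PE solL.
    exists a; rewrite PE solE; apply: eq_big => [j | j _]; first exact: lt_c.
    by rewrite hE.
  by split=> // p' p'_ok; rewrite -(p_uniq P P_ok) (p_uniq p' p'_ok).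
Qed.
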